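(* Let $\sigma$ be a highly computable implicit signature and let $\mathsf{H}$ be a recursively enumerable pseudovariety of groups such that the pseudovariety $\mathsf{DRH}$ is $\sigma$-reducible. Then the pseudovariety $\mathsf{H}$ is also $\sigma$-reducible.
   Context: $\mathsf{S}$ is the pseudovariety of all finite semigroups. For a pseudovariety of groups $\mathsf{H}$, $\mathsf{DRH}$ is the pseudovariety of all finite semigroups whose regular $\mathcal{R}$-classes are groups belonging to $\mathsf{H}$. For a pseudovariety $\mathsf{V}$ and a finite set $A$, $\overline{\Omega}_A\mathsf{V}$ is the free pro-$\mathsf{V}$ semigroup on $A$ and $\rho_{\mathsf{V}}:\overline{\Omega}_A\mathsf{S}\to\overline{\Omega}_A\mathsf{V}$ is the canonical projection; elements of $\overline{\Omega}_A\mathsf{S}$ are called pseudowords. $T^I$ denotes the semigroup $T$ with a new identity $I$ adjoined (for $T=\overline{\Omega}_A\mathsf{S}$, $I$ is called the empty word and is an isolated point). For $u,v\in(\overline{\Omega}_A\mathsf{S})^I$, $u=_{\mathsf{V}}v$ means $\rho_{\mathsf{V}}(u)=\rho_{\mathsf{V}}(v)$, where $\rho_{\mathsf{DRH}}(I)=I$ and, for a pseudovariety of groups $\mathsf{H}$, $\rho_{\mathsf{H}}(I)=1$ is the identity element of $\overline{\Omega}_A\mathsf{H}$. Pseudowords are identified with implicit operations (which act on every profinite semigroup). An implicit signature $\sigma$ is a set of implicit operations (containing multiplication). It is highly computable if it is a recursively enumerable set and all its elements are computable operations. $\Omega^{\sigma}_A\mathsf{S}$ is the $\sigma$-subalgebra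 of $\overline{\Omega}_A\mathsf{S}$ generated by $A$; its elements are called $\sigma$-words. A finite system of equations in a finite set of variables $X$ comes with a constraint for each $x\in X$, namely a clopen subset $K_x\subseteq(\overline{\Omega}_A\mathsf{S})^I$ for a finite alphabet $A$. A solution modulo $\mathsf{V}$ of a system $\{u_i=v_i\}_i$ (with $u_i,v_i\in\overline{\Omega}_X\mathsf{S}$) is a continuous homomorphism $\delta:\overline{\Omega}_X\mathsf{S}\to(\overline{\Omega}_A\mathsf{S})^I$ with $\delta(u_i)=_{\mathsf{V}}\delta(v_i)$ for all $i$ and $\delta(x)\in K_x$ for all $x\in X$. It is a solution in $\sigma$-words if $\delta(X)\subseteq(\Omega^{\sigma}_A\mathsf{S})^I$. For a finite directed graph $\Gamma=V\uplus E$ (vertices $V$, edges $E$, source map $\alpha:E\to V$, target map $\omega:E\to V$), $\mathcal{S}(\Gamma)$ is the system $\{\alpha(e)\,e=\omega(e) : e\in E\}$ in the set of variables $\Gamma=V\uplus E$; such systems are called systems of graph equations. $\mathsf{V}$ is $\sigma$-reducible if, for every finite system of graph equations and every choice of clopen constraints, the existence of a solution modulo $\mathsf{V}$ implies the existence of a solution modulo $\mathsf{V}$ in $\sigma$-words. *)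

(* Defs.v *)
From HB Require Import structures.
From mathcomp Require Import all_boot monoid.
From mathcomp Require Import all_classical.
From mathcomp Require Import topology.

Set Implicit Arguments.
Unset Strict Implicit.
Unset Printing Implicit Defensive.

Local Open Scope group_scope.
Local Open Scope classical_set_scope.

(** * Finite semigroups and pseudovarieties *)

HB.mixin Record isNonempty S := {
  nonempty : inhabited S
}.

(* Finite semigroups are nonempty. *)
#[short(type="finSemigroupType")]
HB.structure Definition FinSemigroup :=
  {S of Semigroup S & Finite S & isNonempty S}.

Definition prod_sg (S T : Type) : Type := (S * T)%type.

Section ProdSemigroup.
Variables S T : finSemigroupType.

HB.instance Definition _ := Finite.on (prod_sg S T).

Definition prod_sg_mul (p q : prod_sg S T) : prod_sg S T :=
  (p.1 * q.1, p.2 * q.2).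

Fact prod_sg_mulA : associative prod_sg_mul.
Proof. by move=> p q r; rewrite /prod_sg_mul /= !mulgA. Qed.

Fact prod_sg_nonempty : inhabited (prod_sg S T).
Proof.
by have [x] := @nonempty S; have [y] := @nonempty T; exists; exact: (x, y).
Qed.

HB.instance Definition _ := isSemigroup.Build (prod_sg S T) prod_sg_mulA.
HB.instance Definition _ := isNonempty.Build (prod_sg S T) prod_sg_nonempty.

End ProdSemigroup.

Definition all_semigroups (S : finSemigroupType) : Prop := True.

Record pseudovariety (V : finSemigroupType -> Prop) : Prop := Pseudovariety {
  pv_nonempty : exists S, V S;
  pv_sub : forall (S T : finSemigroupType) (f : {multiplicative T -> S}),
    injective f -> V S -> V T;
  pv_quo : forall (S T : finSemigroupType) (f : {multiplicative S -> T}),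
    (forall y, exists x, f x = y) -> V S -> V T;
  pv_prod : forall S T : finSemigroupType, V S -> V T -> V (prod_sg S T)
}.

Definition neutral (S : semigroupType) (e : S) : Prop :=
  forall x, e * x = x /\ x * e = x.

Definition is_group (S : semigroupType) : Prop :=
  exists e : S, neutral e /\ forall x, exists y, x * y = e /\ y * x = e.

Definition all_groups (V : finSemigroupType -> Prop) : Prop :=
  forall S, V S -> is_group S.

Definition group_pseudovariety (H : finSemigroupType -> Prop) : Prop :=
  pseudovariety H /\ all_groups H.

(** * The pseudovariety DRH *)

Definition le_R (S : semigroupType) (x y : S) : Prop :=
  x = y \/ exists z, x = y * z.

Definition R_class (S : semigroupType) (x : S) : set S :=
  [set y | le_R x y /\ le_R y x].

Definition regular (S : semigroupType) (x : S) : Prop :=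
  exists y, x * y * x = x.

(* The subset [C] of [S] is a subsemigroup which is a group in [H], phrased
   through an isomorphic copy [G] of [C]. *)
Definition is_group_in (H : finSemigroupType -> Prop) (S : semigroupType)
    (C : set S) : Prop :=
  exists (G : finSemigroupType) (i : {multiplicative G -> S}),
    [/\ H G, is_group G, injective i & range i = C].

Definition DRH (H : finSemigroupType -> Prop) (S : finSemigroupType) : Prop :=
  forall x : S, regular x -> is_group_in H (R_class x).

(** * Free pro-V semigroups *)

(* The free pro-V semigroup on [A], realized as the semigroup of [A]-ary
   implicit operations on [V], that is, of the families of maps S^A -> S
   (S in V) that commute with all homomorphisms between members of V. *)
Record free_pro (V : finSemigroupType -> Prop) (A : Type) : Type := FreePro {
  eval :> forall S : finSemigroupType, V S -> (A -> S) -> S;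
  eval_natural : forall (S T : finSemigroupType) (VS : V S) (VT : V T)
    (f : {multiplicative S -> T}) (s : A -> S),
    f (eval VS s) = eval VT (f \o s)
}.

Section FreePro.
Variables (V : finSemigroupType -> Prop) (A : Type).
Implicit Types u v w : free_pro V A.

Lemma free_pro_ext u v :
  (forall (S : finSemigroupType) (VS : V S) s, u S VS s = v S VS s) -> u = v.
Proof.
case: u v => [u nu] [v nv] /= uv.
have {}uv : u = v.
  by apply: functional_extensionality_dep => S; apply/funext => VS;
     apply/funext => s; apply: uv.
by case: _ / uv nv => nv; congr FreePro; apply: Prop_irrelevance.
Qed.

Definition generator (a : A) : free_pro V A :=
  @FreePro V A (fun S VS s => s a) (fun S T VS VT f s => erefl).

Fact free_pro_mul_natural u v (S T : finSemigroupType) (VS : V S) (VT : V T)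
    (f : {multiplicative S -> T}) (s : A -> S) :
  f (u S VS s * v S VS s) = u T VT (f \o s) * v T VT (f \o s).
Proof. by rewrite gmulfM !(eval_natural _ _ VT). Qed.

Definition free_pro_mul u v : free_pro V A :=
  FreePro (free_pro_mul_natural u v).

Fact free_pro_mulA : associative free_pro_mul.
Proof. by move=> u v w; apply: free_pro_ext => S VS s /=; rewrite mulgA. Qed.

HB.instance Definition _ := gen_eqMixin (free_pro V A).
HB.instance Definition _ := gen_choiceMixin (free_pro V A).
HB.instance Definition _ := isSemigroup.Build (free_pro V A) free_pro_mulA.

(* The profinite topology: the coarsest one for which all evaluation maps
   u |-> u S VS s into the finite discrete semigroups S of V are continuous. *)
Definition cylinders : set (set (free_pro V A)) :=
  [set U | exists (S : finSemigroupType) (VS : V S) (s : A -> S) (t : S),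
             U = [set u : free_pro V A | u S VS s = t]].

HB.instance Definition _ :=
  @isSubBaseTopological.Build (free_pro V A) (set (free_pro V A)) cylinders id.

End FreePro.

(* Pseudowords are implicit operations on all finite semigroups. *)
Notation pseudoword := (free_pro all_semigroups).

Fact act_natural (V : finSemigroupType -> Prop) (B A : Type) (p : free_pro V B)
    (w : B -> free_pro V A) (S T : finSemigroupType) (VS : V S) (VT : V T)
    (f : {multiplicative S -> T}) (s : A -> S) :
  f (p S VS (fun b => w b S VS s)) = p T VT (fun b => w b T VT (f \o s)).
Proof.
rewrite (eval_natural _ _ VT); congr (p T VT _); apply/funext => b /=.
exact: eval_natural.
Qed.

(* The value of the [B]-ary implicit operation [p] at a [B]-tuple of elements of
   the profinite semigroup [free_pro V A]. *)
Definition act (V : finSemigroupType -> Prop) (B A : Type) (p : free_pro V B)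
    (w : B -> free_pro V A) : free_pro V A :=
  FreePro (act_natural p w).

(** * Adjoining the empty word *)

(* [None] is the adjoined identity. A notation rather than a definition, so
   that [adjI] applies to types of different universe levels. *)
Notation adjI T := (option T).

Section AdjSemigroup.
Variable T : semigroupType.

Definition adjI_mul (u v : adjI T) : adjI T :=
  match u, v with
  | Some x, Some y => Some (x * y)
  | None, _ => v
  | _, None => u
  end.

Fact adjI_mulA : associative adjI_mul.
Proof. by move=> [x|] [y|] [z|] //=; rewrite mulgA. Qed.

HB.instance Definition _ := isSemigroup.Build (adjI T) adjI_mulA.

End AdjSemigroup.

Section AdjTopology.
Variable T : topologicalType.

(* The disjoint sum topology: the point [None] is isolated. *)
Definition adjI_open (U : set (adjI T)) : Prop := open (Some @^-1` U).

Fact adjI_openT : adjI_open setT.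
Proof. exact: openT. Qed.

Fact adjI_openI : setI_closed adjI_open.
Proof. by move=> U W; exact: openI. Qed.

Fact adjI_open_bigU (I : Type) (f : I -> set (adjI T)) :
  (forall i, adjI_open (f i)) -> adjI_open (\bigcup_i f i).
Proof.
move=> open_f; rewrite /adjI_open preimage_bigcup.
by apply: bigcup_open => i _; exact: open_f.
Qed.

HB.instance Definition _ :=
  isOpenTopological.Build (adjI T) adjI_openT adjI_openI adjI_open_bigU.

End AdjTopology.

(** * Equality modulo a pseudovariety *)

Section EqMod.
Variables (V : finSemigroupType -> Prop) (A : Type).

(* The canonical projection: the restriction of implicit operations to V. *)
Definition rho (u : pseudoword A) : free_pro V A :=
  @FreePro V A (fun S _ s => u S Logic.I s)
    (fun S T _ _ f s => eval_natural u Logic.I Logic.I f s).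

(* The identity element of [free_pro V A] when V consists of groups. *)
Section Identity.
Hypothesis grpV : all_groups V.

Definition group_one (S : finSemigroupType) (VS : V S) : S :=
  sval (cid (grpV VS)).

Fact group_oneP (S : finSemigroupType) (VS : V S) : neutral (group_one VS).
Proof. exact: (svalP (cid (grpV VS))).1. Qed.

Fact group_one_natural (S T : finSemigroupType) (VS : V S) (VT : V T)
  (f : {multiplicative S -> T}) : f (group_one VS) = group_one VT.
Proof.
have ff : f (group_one VS) * f (group_one VS) = f (group_one VS).
  by rewrite -gmulfM (group_oneP VS _).1.
have [y [_ yf]] := (svalP (cid (grpV VT))).2 (f (group_one VS)).
by rewrite -[LHS](group_oneP VT _).1 -{1}[group_one VT]yf -mulgA ff.
Qed.

Definition free_pro_one : free_pro V A :=
  @FreePro V A (fun S VS _ => group_one VS)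
    (fun S T VS VT f _ => group_one_natural VS VT f).

End Identity.

(* The empty word is sent to the identity of [free_pro V A] if V consists of
   groups, and to the adjoined identity otherwise (as is the case for DRH). *)
Definition rhoI (u : adjI (pseudoword A)) : adjI (free_pro V A) :=
  match u with
  | Some w => Some (rho w)
  | None => match pselect (all_groups V) with
            | left grpV => Some (free_pro_one grpV)
            | right _ => None
            end
  end.

Definition eq_mod (u v : adjI (pseudoword A)) : Prop := rhoI u = rhoI v.

End EqMod.

(** * Systems of equations *)

(* [pseudoword X] has no identity, so a morphism into [adjI (pseudoword A)] is
   just a multiplicative map. *)
Definition solution_mod (V : finSemigroupType -> Prop) (X A I : finType)
    (lhs rhs : I -> pseudoword X) (K : X -> set (adjI (pseudoword A)))
    (delta : {multiplicative pseudoword X -> adjI (pseudoword A)}) : Prop :=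
  [/\ continuous delta,
      forall i, eq_mod V (delta (lhs i)) (delta (rhs i))
    & forall x, K x (delta (generator _ x))].

Record digraph : Type := Digraph {
  vertex : finType;
  edge : finType;
  source : edge -> vertex;
  target : edge -> vertex
}.

Section GraphSystem.
Variable G : digraph.

Definition graph_var : finType := (vertex G + edge G)%type.

Definition vertex_word (v : vertex G) : pseudoword graph_var :=
  generator _ (inl v).
Definition edge_word (e : edge G) : pseudoword graph_var :=
  generator _ (inr e).

Definition graph_lhs (e : edge G) : pseudoword graph_var :=
  vertex_word (source e) * edge_word e.
Definition graph_rhs (e : edge G) : pseudoword graph_var :=
  vertex_word (target e).

End GraphSystem.

(** * Implicit signatures and reducibility *)

(* [sigma n] is the set of [n]-ary members of the set [sigma]. *)
Definition operation_set : Type := forall n : nat, set (pseudoword 'I_n).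

Definition mul_operation : pseudoword 'I_2 :=
  generator _ ord0 * generator _ ord_max.

Definition implicit_signature (sigma : operation_set) : Prop :=
  sigma 2 mul_operation.

Inductive sigma_word (sigma : operation_set) (A : Type) : set (pseudoword A) :=
| SigmaGenerator a : sigma_word sigma (generator _ a)
| SigmaOperation n (p : pseudoword 'I_n) (w : 'I_n -> pseudoword A) :
    sigma n p -> (forall i, sigma_word sigma (w i)) ->
    sigma_word sigma (act p w).

Definition sigma_wordI (sigma : operation_set) (A : Type) :
    set (adjI (pseudoword A)) :=
  [set u | if u is Some w then sigma_word sigma w else True].

Definition reducible (sigma : operation_set) (V : finSemigroupType -> Prop) :
    Prop :=
  forall (G : digraph) (A : finType)
         (K : graph_var G -> set (adjI (pseudoword A))),
    (forall x, clopen (K x)) ->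
    (exists delta, solution_mod V (@graph_lhs G) (@graph_rhs G) K delta) ->
    exists delta,
      solution_mod V (@graph_lhs G) (@graph_rhs G) K delta /\
      forall x, sigma_wordI sigma (delta (generator _ x)).

(** * Computability *)

(* Partial functions from N^n to N, given by their graphs. *)
Definition pfun (n : nat) : Type := n.-tuple nat -> nat -> Prop.

Inductive partial_recursive : forall n, pfun n -> Prop :=
| PRzero n : @partial_recursive n (fun _ y => y = 0)
| PRsucc : @partial_recursive 1 (fun v y => y = (thead v).+1)
| PRproj n (i : 'I_n) : @partial_recursive n (fun v y => y = tnth v i)
| PRcomp m n (f : pfun m) (g : 'I_m -> pfun n) :
    partial_recursive f -> (forall i, partial_recursive (g i)) ->
    @partial_recursive n
      (fun v y => exists w : m.-tuple nat,
         (forall i, g i v (tnth w i)) /\ f w y)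
  (* [t k] is the value of the function defined by recursion at [k] *)
| PRrec n (f : pfun n) (g : pfun n.+2) :
    partial_recursive f -> partial_recursive g ->
    @partial_recursive n.+1
      (fun v y => exists t : nat -> nat,
         [/\ f (behead_tuple v) (t 0),
             forall k, (k < thead v)%N ->
               g [tuple of k :: t k :: behead_tuple v] (t k.+1)
           & y = t (thead v)])
| PRmu n (f : pfun n.+1) :
    partial_recursive f ->
    @partial_recursive n
      (fun v y => f [tuple of y :: v] 0 /\
         forall k, (k < y)%N -> exists z, f [tuple of k :: v] z.+1).

Definition recursively_enumerable (P : set nat) : Prop :=
  exists2 f : pfun 1, partial_recursive f &
    forall c, P c <-> exists y, f [tuple c] y.

(* A finite semigroup is coded by its multiplication table, and its elements
   by their ranks in its enumeration. *)
Definition code_semigroup (S : finSemigroupType) : nat :=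
  CodeSeq.code [seq nat_of_ord (enum_rank (x * y)) | x <- enum S, y <- enum S].

Definition code_args (S : finSemigroupType) n (s : 'I_n -> S) : nat :=
  CodeSeq.code [seq nat_of_ord (enum_rank (s i)) | i <- enum 'I_n].

(* By isomorphism-invariance, every table of a member of V on {0, ..., n-1}
   is the code of some member of V. *)
Definition re_pseudovariety (V : finSemigroupType -> Prop) : Prop :=
  recursively_enumerable [set c | exists2 S, V S & code_semigroup S = c].

Definition computable_operation n (p : pseudoword 'I_n) : Prop :=
  exists2 f : pfun 2, partial_recursive f &
    forall (S : finSemigroupType) (s : 'I_n -> S),
      f [tuple code_semigroup S; code_args s] (enum_rank (p S Logic.I s)).

(* Implicit operations being infinite objects, they are enumerated through
   algorithms computing them: the index [c] presents [p] if [arity] returns the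
   arity of [p] on [c] and the algorithm [U c] computes [p]. *)
Definition presents (arity : pfun 1) (U : pfun 3) (c : nat) n
    (p : pseudoword 'I_n) : Prop :=
  arity [tuple c] n /\
  forall (S : finSemigroupType) (s : 'I_n -> S),
    U [tuple c; code_semigroup S; code_args s] (enum_rank (p S Logic.I s)).

Definition re_operation_set (sigma : operation_set) : Prop :=
  exists (W : set nat) (arity : pfun 1) (U : pfun 3),
    [/\ recursively_enumerable W, partial_recursive arity,
        partial_recursive U,
        forall c, W c -> exists n (p : pseudoword 'I_n),
          sigma n p /\ presents arity U c p
      & forall n (p : pseudoword 'I_n), sigma n p ->
          exists2 c, W c & presents arity U c p].

Definition highly_computable (sigma : operation_set) : Prop :=
  re_operation_set sigma /\
  forall n (p : pseudoword 'I_n), sigma n p -> computable_operation p.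

(* Main.v *)
From HB Require Import structures.
From mathcomp Require Import all_boot monoid finmap.
From mathcomp Require Import all_classical.
From mathcomp Require Import topology.
Require Import Defs.

Set Implicit Arguments.
Unset Strict Implicit.
Unset Printing Implicit Defensive.

Local Open Scope group_scope.
Local Open Scope classical_set_scope.

(** The idea is to turn equality modulo [H] into equality modulo [DRH H] by
    multiplying on the left by an idempotent [f] whose content is the whole
    alphabet [A]: here [f] is the omega-power of a product of all letters.

    In a member [S] of [DRH H], let [e] be the value of [f] under a valuation
    [s] of the letters.  The R-class of [e] is a group [G] of [H] with identity
    [e].  The idempotent [e] is a product in which every letter occurs, and
    all products [e * p], for [p] a prefix of it, are R-equivalent to [e];
    taking quotients in [G] of two consecutive ones shows that [e * s a] lies
    in [G] for each letter [a].  Hence [e * u], for any pseudoword [u], is just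
    the value of [u] in [G] when [a] is evaluated as [e * s a].  So [u = v]
    modulo [H] implies [f * u = f * v] modulo [DRH H] (lemma [absorb]).

    Now let [d] be a solution modulo [H] of the system of a graph [G].  Add to
    [G] a root, and an edge from the root to each vertex [v] (definition
    [rooted]).  Sending the root to [f], each new edge to the old value [d v] of
    its target, each old vertex [v] to [f * d v], and each old edge to its old
    value, one gets a solution modulo [DRH H].  The constraint on [v] is moved
    to the new edge that ends in [v], while all vertices become unconstrained.
    Reducibility of [DRH H] gives a solution [d1] in sigma-words.  Since [H] is
    contained in [DRH H], it holds modulo [H], where the value of the root can
    be cancelled: the values under [d1] of the new edges and of the old edges
    are then a solution of the system of [G], which satisfies the original
    constraints.

    If [A] is empty there is no such [f], but then there are no pseudowords
    over [A] either (lemma [pseudoword_empty]), so that [d] only takes the empty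
    word as its value.

    Solutions are continuous morphisms, whereas the argument only prescribes
    the images of the variables; lemma [extension], the universal property of
    the free profinite semigroup with respect to [adjI (pseudoword A)], fills
    this gap. *)

(** * Finite semigroups *)

HB.instance Definition _ (S : finSemigroupType) :=
  isNonempty.Build (adjI S) (inhabits None).

Definition unit_mul (x y : unit) : unit := tt.

Fact unit_mulA : associative unit_mul.
Proof. by []. Qed.

HB.instance Definition _ := isSemigroup.Build unit unit_mulA.
HB.instance Definition _ := isNonempty.Build unit (inhabits tt).

Definition multiplicative_of (S T : semigroupType) (f : S -> T)
    (fM : {morph f : x y / x * y}) : {multiplicative S -> T} :=
  HB.pack f (isMultiplicative.Build S T f fM).

Lemma omapM (S T : semigroupType) (f : {multiplicative S -> T}) :
  {morph (omap f : adjI S -> adjI T) : x y / x * y}.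
Proof. by move=> [x|] [y|] //=; congr Some; rewrite gmulfM. Qed.

Definition adjI_map (S T : semigroupType) (f : {multiplicative S -> T}) :
    {multiplicative adjI S -> adjI T} := multiplicative_of (omapM f).

Lemma group_idem_neutral (S : semigroupType) (x : S) :
  is_group S -> x * x = x -> neutral x.
Proof.
move=> [e [e1 inv]] xx; have [y [_ yx]] := inv x.
suff -> : x = e by [].
by rewrite -[LHS](e1 _).1 -{1}yx -mulgA xx.
Qed.

Lemma neutral_unique (S : semigroupType) (x y : S) :
  neutral x -> neutral y -> x = y.
Proof. by move=> x1 y1; rewrite -[LHS](y1 _).1 (x1 _).2. Qed.

Lemma group_cancel (S : semigroupType) (x y z : S) :
  is_group S -> x * y = x * z -> y = z.
Proof.
move=> [e [e1 inv]] xyz; have [t [_ tx]] := inv x.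
by rewrite -[y](e1 _).1 -[z](e1 _).1 -tx -!mulgA xyz.
Qed.

Section SubSemigroup.
Variables (S : finSemigroupType) (P : {pred S}).
Hypothesis PM : forall x y, x \in P -> y \in P -> x * y \in P.
Hypothesis P0 : exists x, x \in P.

(** The two hypotheses are arguments of the type, so that its semigroup
    structure can be inferred from it. *)
Definition sub_sg of (forall x y, x \in P -> y \in P -> x * y \in P)
  & (exists x, x \in P) : Type := {x | x \in P}.
Local Notation T := (sub_sg PM P0).

HB.instance Definition _ := Finite.on T.

Definition sub_sg_mul (x y : T) : T :=
  exist (fun z => z \in P) _ (PM (svalP x) (svalP y)).

Fact sub_sg_mulA : associative sub_sg_mul.
Proof. by move=> x y z; apply: val_inj; rewrite /= mulgA. Qed.

Fact sub_sg_nonempty : inhabited T.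
Proof. by case: P0 => x Px; exists; exists x. Qed.

HB.instance Definition _ := isSemigroup.Build T sub_sg_mulA.
HB.instance Definition _ := isNonempty.Build T sub_sg_nonempty.

Definition sub_sg_val : {multiplicative T -> S} :=
  @multiplicative_of T S sval (fun x y => erefl).

End SubSemigroup.

(** A valuation into a subsemigroup has its value there: this is naturality
    with respect to the inclusion.  Without letters [P] could be empty. *)
Lemma eval_closed (A : Type) (u : pseudoword A) (S : finSemigroupType)
    (P : {pred S}) (s : A -> S) :
  (forall x y, x \in P -> y \in P -> x * y \in P) -> inhabited A ->
  (forall a, s a \in P) -> u S Logic.I s \in P.
Proof.
move=> PM [a0] Ps.
have P0 : exists x, x \in P by exists (s a0).
pose s' a : sub_sg PM P0 := exist (fun x => x \in P) (s a) (Ps a).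
have <- := eval_natural u Logic.I Logic.I (sub_sg_val PM P0) s'.
by case: (u _ Logic.I s').
Qed.

(** * Idempotent powers *)

(** This is x^(n+1): a semigroup has no zeroth power. *)
Definition pow (S : semigroupType) (x : S) n := iter n (mul x) x.

Lemma powS (S : semigroupType) (x : S) n : pow x n.+1 = x * pow x n.
Proof. by []. Qed.

Lemma powD (S : semigroupType) (x : S) m n :
  pow x m * pow x n = pow x (m + n).+1.
Proof. by elim: m => //= m IH; rewrite -mulgA IH. Qed.

Lemma pow_pow (S : semigroupType) (x : S) m n :
  pow (pow x m) n = pow x (m + n * m.+1).
Proof.
elim: n => [|n IH]; first by rewrite mul0n addn0.
by rewrite powS IH powD mulSn; congr pow; rewrite addSn addnS addnA.
Qed.

Lemma pow_idem (S : semigroupType) (x : S) n : x * x = x -> pow x n = x.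
Proof. by move=> xx; elim: n => //= n ->. Qed.

Lemma pow_morph (S T : semigroupType) (f : {multiplicative S -> T}) x n :
  f (pow x n) = pow (f x) n.
Proof. by elim: n => //= n IH; rewrite gmulfM IH. Qed.

(** The powers of [x] are eventually periodic, and a power whose exponent is
    large enough and a multiple of the period is idempotent. *)
Lemma idem_pow_exists (S : finSemigroupType) (x : S) :
  exists e : S, e * e = e /\ exists n, e = pow x n.
Proof.
have [i [k eq_ik]] : exists i k, pow x i = pow x (i + k.+1).
  have /injectivePn [i [j neq_ij eq_ij]] :
      ~~ injectiveb (fun i : 'I_#|S|.+1 => pow x i).
    by apply/negP => /injectiveP /leq_card; rewrite card_ord ltnn.
  wlog lt_ij : i j neq_ij eq_ij / (i < j)%N.
    move=> th; have := neq_ij; rewrite neq_ltn => /orP[] lt; first exact: (th i j).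
    by apply: (th j i) => //; rewrite eq_sym.
  by exists i, (j - i).-1; rewrite prednK ?subn_gt0 // subnKC // ltnW.
have step m : (i <= m)%N -> pow x (m + k.+1) = pow x m.
  move=> /subnK <-; case: (m - i)%N => [|d]; first by rewrite add0n.
  by rewrite -addnA !addSn -!powD eq_ik.
have period c m : (i <= m)%N -> pow x (m + c * k.+1) = pow x m.
  move=> le_im; elim: c => [|c IH]; first by rewrite mul0n addn0.
  by rewrite mulSnr addnA step // (leq_trans le_im) ?leq_addr.
(* [pow x n] has exponent [n.+1], a multiple of the period [k.+1]. *)
pose n := (i.+1 * k.+1).-1.
have nE : n.+1 = (i.+1 * k.+1)%N by rewrite /n prednK // muln_gt0.
exists (pow x n); split; last by exists n.
rewrite powD -addnS nE; apply: period.
by rewrite -ltnS nE leq_pmulr.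
Qed.

(** An idempotent is equal to all its powers, and x^((m+1)(n+1)) is a power of
    both sides. *)
Lemma idem_pow_unique (S : semigroupType) (x : S) m n :
  pow x m * pow x m = pow x m -> pow x n * pow x n = pow x n ->
  pow x m = pow x n.
Proof.
move=> mm nn; rewrite -(pow_idem n mm) -[RHS](pow_idem m nn) !pow_pow.
by congr pow; rewrite !mulnS addnCA [(n * m)%N]mulnC.
Qed.

Definition omega (S : finSemigroupType) (x : S) : S :=
  sval (cid (idem_pow_exists x)).

Lemma omega_idem (S : finSemigroupType) (x : S) : omega x * omega x = omega x.
Proof. exact: (svalP (cid (idem_pow_exists x))).1. Qed.

Lemma omega_pow (S : finSemigroupType) (x : S) : exists n, omega x = pow x n.
Proof. exact: (svalP (cid (idem_pow_exists x))).2. Qed.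

(** It is uniqueness of the idempotent power that makes it commute with
    morphisms, hence an implicit operation. *)
Lemma omega_morph (S T : finSemigroupType) (f : {multiplicative S -> T}) x :
  f (omega x) = omega (f x).
Proof.
have [m em] := omega_pow x; have [n en] := omega_pow (f x).
rewrite em en pow_morph; apply: idem_pow_unique.
  by rewrite -pow_morph -em -gmulfM omega_idem.
by rewrite -en omega_idem.
Qed.

Fact omega_word_natural (A : Type) (u : pseudoword A) (S T : finSemigroupType)
    (VS : all_semigroups S) (VT : all_semigroups T)
    (f : {multiplicative S -> T}) (s : A -> S) :
  f (omega (u S VS s)) = omega (u T VT (f \o s)).
Proof. by rewrite omega_morph (eval_natural _ _ VT). Qed.

Definition omega_word (A : Type) (u : pseudoword A) : pseudoword A :=
  FreePro (omega_word_natural u).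

(** * The universal property of the free profinite monoid *)

Section Extension.
Variable A : Type.
Implicit Types u v : adjI (pseudoword A).

(** An element of [adjI (pseudoword A)] is viewed as an operation with values
    in [adjI S]; a map into [adjI (pseudoword A)] can then be defined, and
    shown to be multiplicative and continuous, one finite semigroup at a
    time. *)
Definition evalI u (S : finSemigroupType) (s : A -> S) : adjI S :=
  omap (fun w : pseudoword A => w S Logic.I s) u.

Lemma evalI_inj u v :
  (forall (S : finSemigroupType) (s : A -> S), evalI u s = evalI v s) -> u = v.
Proof.
case: u v => [u|] [v|] //= uv; last 2 first.
- by have := uv unit (fun=> tt).
- by have := uv unit (fun=> tt).
congr Some; apply: free_pro_ext => S VS s; rewrite (Prop_irrelevance VS Logic.I).
by have [] := uv S s.
Qed.

Lemma evalIM u v (S : finSemigroupType) (s : A -> S) :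
  evalI (u * v) s = evalI u s * evalI v s.
Proof. by case: u v => [u|] [v|]. Qed.

Lemma evalI_natural u (S T : finSemigroupType) (f : {multiplicative S -> T})
    (s : A -> S) :
  omap f (evalI u s) = evalI u (f \o s).
Proof. by case: u => [u|] //=; rewrite (eval_natural _ _ Logic.I). Qed.

(** By naturality with respect to the map to the trivial semigroup, a natural
    family with values in [adjI S] is either constantly [None] or never
    [None], and in the second case it is an implicit operation. *)
Lemma evalI_realize (F : forall S : finSemigroupType, (A -> S) -> adjI S) :
  (forall (S T : finSemigroupType) (f : {multiplicative S -> T}) (s : A -> S),
     omap f (F S s) = F T (f \o s)) ->
  exists u, forall (S : finSemigroupType) (s : A -> S), evalI u s = F S s.
Proof.
move=> Fnat.
have Funit (S : finSemigroupType) (s : A -> S) :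
    omap (fun=> tt) (F S s) = F unit (fun=> tt).
  exact: (Fnat S unit (@multiplicative_of S unit (fun=> tt) (fun x y => erefl))).
case E : (F unit (fun=> tt)) => [t|]; last first.
  by exists None => S s; have := Funit S s; rewrite E; case: (F S s).
have FS (S : finSemigroupType) (s : A -> S) : exists x, F S s = Some x.
  by have := Funit S s; rewrite E; case: (F S s) => // x _; exists x.
pose ev (S : finSemigroupType) (_ : all_semigroups S) s := sval (cid (FS S s)).
have evE S VS s : F S s = Some (ev S VS s) by exact: svalP (cid (FS S s)).
have ev_nat (S T : finSemigroupType) VS VT (f : {multiplicative S -> T}) s :
    f (ev S VS s) = ev T VT (f \o s).
  by have := Fnat S T f s; rewrite (evE S VS) (evE T VT) /= => -[].
by exists (Some (FreePro ev_nat)) => S s; rewrite (evE S Logic.I).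
Qed.

End Extension.

Lemma nbhs_free_pro (V : finSemigroupType -> Prop) (A : Type)
    (u : free_pro V A) (U : set (free_pro V A)) :
  nbhs u U ->
  exists2 E : {fset set (free_pro V A)},
    forall C, C \in E -> @cylinders V A C &
    forall v, (forall C, C \in E -> C u -> C v) -> U v.
Proof.
rewrite nbhsE => -[W [oW Wu] sWU].
case: oW => D' sD' WE; move: Wu; rewrite -WE => -[C D'C Cu].
have [E sE CE] := sD' _ D'C.
exists E => [B /sE|v Ev]; first by rewrite inE.
apply: sWU; rewrite -WE; exists C => //.
rewrite -CE in Cu *.
by move=> B EB; apply: Ev => //; apply: Cu.
Qed.

Lemma nbhs_eval (V : finSemigroupType -> Prop) (A : Type) (u : free_pro V A)
    (S : finSemigroupType) (VS : V S) (s : A -> S) :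
  nbhs u [set v : free_pro V A | v S VS s = u S VS s].
Proof.
apply: open_nbhs_nbhs; split=> //.
set C := [set _ | _].
exists [set C]; last by rewrite bigcup_set1.
by move=> _ ->; apply: finI_from1; exists S, VS, s, (u S VS s).
Qed.

(** Continuity can be tested on evaluations, the evaluation in the trivial
    semigroup taking care of the isolated point [None]. *)
Lemma continuous_evalI (Y : topologicalType) (A : Type)
    (g : Y -> adjI (pseudoword A)) :
  (forall (S : finSemigroupType) (s : A -> S) (y : Y),
     nbhs y [set z | evalI (g z) s = evalI (g y) s]) ->
  continuous g.
Proof.
move=> cst y U; rewrite nbhsE => -[W [oW Wgy] sWU].
have n1 := cst unit (fun=> tt) y.
apply: filterS (_ : nbhs y (g @^-1` W)); first by move=> z; apply: sWU.
case gyE : (g y) Wgy n1 => [u|] Wu n1; last first.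
  by apply: filterS n1 => z /=; case: (g z).
have nW : nbhs u (Some @^-1` W) by exact: open_nbhs_nbhs.
have [E cylE EW] := nbhs_free_pro nW.
pose f (C : set (pseudoword A)) := [set z | forall v, g z = Some v -> C u -> C v].
have nE : nbhs y (\bigcap_(C in [set` E]) f C).
  apply: filter_bigI => C /cylE [S [VS [s [t ->]]]].
  apply: filterS (cst S s y) => z /= eq_z v gz <-.
  rewrite gyE gz in eq_z; case: eq_z.
  by rewrite (Prop_irrelevance VS Logic.I).
apply: filterS (filterI n1 nE) => z /= [].
case gz : (g z) => [v|] // _ fz.
by apply: EW => C EC; apply: fz EC _ gz.
Qed.

(** The value of an implicit operation [p] at [w] is computed in the finite
    semigroup [adjI S] for each evaluation of the [w x] in [S]. *)
Lemma extension (X A : Type) (w : X -> adjI (pseudoword A)) :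
  exists delta : {multiplicative pseudoword X -> adjI (pseudoword A)},
    continuous delta /\ forall x, delta (generator _ x) = w x.
Proof.
pose F (p : pseudoword X) (S : finSemigroupType) (s : A -> S) : adjI S :=
  p (adjI S : finSemigroupType) Logic.I (fun x => evalI (w x) s).
have Fnat p (S T : finSemigroupType) (f : {multiplicative S -> T}) s :
    omap f (F p S s) = F p T (f \o s).
  rewrite /F; have := eval_natural p Logic.I Logic.I (adjI_map f)
    (fun x => evalI (w x) s : (adjI S : finSemigroupType)).
  move=> /= ->; congr (p _ _ _); apply/funext => x /=.
  exact: evalI_natural.
have /choice [delta deltaE] p := evalI_realize (Fnat p).
have deltaM : {morph delta : p q / p * q}.
  by move=> p q; apply: evalI_inj => S s; rewrite evalIM !deltaE.
exists (multiplicative_of deltaM); split; last first.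
  by move=> x; apply: evalI_inj => S s; rewrite deltaE.
apply: continuous_evalI => S s p.
apply: filterS (nbhs_eval p (S := adjI S) Logic.I (fun x => evalI (w x) s)).
by move=> q /=; rewrite !deltaE.
Qed.

(** * Equality modulo a pseudovariety of groups *)

Section EqModGroup.
Variables (V : finSemigroupType -> Prop) (A : Type).
Hypothesis grpV : all_groups V.
Implicit Types u v : adjI (pseudoword A).

(** Modulo groups, the empty word is evaluated as the identity, and
    [eq_mod V] is equality of all values in the members of [V]. *)
Definition group_eval u (S : finSemigroupType) (VS : V S) (s : A -> S) : S :=
  if u is Some w then w S Logic.I s else group_one grpV VS.

Lemma group_evalM u v (S : finSemigroupType) (VS : V S) (s : A -> S) :
  group_eval (u * v) VS s = group_eval u VS s * group_eval v VS s.
Proof.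
case: u v => [u|] [v|] //=; first by rewrite (group_oneP grpV VS _).2.
  by rewrite (group_oneP grpV VS _).1.
by rewrite (group_oneP grpV VS _).1.
Qed.

Lemma rhoI_group u : exists2 z : free_pro V A, rhoI V u = Some z &
  forall (S : finSemigroupType) (VS : V S) s, z S VS s = group_eval u VS s.
Proof.
case: u => [u|] /=; first by exists (rho V u).
case: pselect => // grpV'; exists (free_pro_one A grpV') => // S VS s /=.
by rewrite (Prop_irrelevance grpV' grpV).
Qed.

Lemma eq_mod_group u v : eq_mod V u v <->
  forall (S : finSemigroupType) (VS : V S) (s : A -> S),
    group_eval u VS s = group_eval v VS s.
Proof.
rewrite /eq_mod; have [x -> xu] := rhoI_group u; have [y -> yv] := rhoI_group v.
split=> [[xy] S VS s|uv]; first by rewrite -xu -yv xy.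
by congr Some; apply: free_pro_ext => S VS s; rewrite xu yv.
Qed.

End EqModGroup.

(** The empty word is sent to an adjoined identity modulo [V] if [V] does not
    consist of groups, but to the identity of the free pro-[W] group. *)
Lemma eq_mod_sub (V W : finSemigroupType -> Prop) (A : Type)
    (u v : adjI (pseudoword A)) :
  (forall S, W S -> V S) -> all_groups W -> eq_mod V u v -> eq_mod W u v.
Proof.
move=> sWV grpW; have [grpV|ngrpV] := pselect (all_groups V).
  move=> /(eq_mod_group grpV) uv; apply/(eq_mod_group grpW) => S WS s.
  have := uv S (sWV S WS) s.
  have oneE : group_one grpV (sWV S WS) = group_one grpW WS.
    exact: neutral_unique (group_oneP grpV _) (group_oneP grpW WS).
  by case: u v {uv} => [u|] [v|] //=; rewrite oneE.
rewrite /eq_mod; case: u v => [u|] [v|] //=; last 2 first.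
- by case: pselect.
- by case: pselect.
move=> /Some_inj uv; congr Some; apply: free_pro_ext => S WS s /=.
by have := congr1 (fun z : free_pro V A => z S (sWV S WS) s) uv.
Qed.

(** * Multiplying on the left by an idempotent of full content *)

Lemma group_sub_DRH (H : finSemigroupType -> Prop) (S : finSemigroupType) :
  all_groups H -> H S -> DRH H S.
Proof.
move=> grpH HS x _; exists S, (@multiplicative_of S S id (fun x y => erefl)).
split=> //; first exact: grpH.
rewrite /= image_id; apply/seteqP; split=> // y _.
have [e [e1 inv]] := grpH S HS.
have le (a b : S) : le_R a b.
  have [c [bc _]] := inv b.
  by right; exists (c * a); rewrite mulgA bc (e1 _).1.
by split.
Qed.

Lemma le_R_mul (S : semigroupType) (x y : S) : le_R (x * y) x.
Proof. by right; exists y. Qed.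

Lemma le_R_trans (S : semigroupType) (x y z : S) :
  le_R x y -> le_R y z -> le_R x z.
Proof.
move=> [->//|[a ->]] [->|[b ->]]; right; first by exists a.
by exists (b * a); rewrite mulgA.
Qed.

Definition foldmul (S : semigroupType) (A : Type) (s : A -> S) :=
  foldl (fun x a => x * s a).

Lemma foldmul_mull (S : semigroupType) (A : Type) (s : A -> S) x y l :
  x * foldmul s y l = foldmul s (x * y) l.
Proof. by elim: l y => //= a l IH y; rewrite IH mulgA. Qed.

Lemma foldmul_le (S : semigroupType) (A : Type) (s : A -> S) x l :
  le_R (foldmul s x l) x.
Proof.
elim: l x => [|a l IH] x /=; first by left.
exact: le_R_trans (IH _) (le_R_mul _ _).
Qed.

Lemma eval_foldmul (A : Type) (u : pseudoword A) l (S : finSemigroupType)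
    (s : A -> S) :
  foldmul (@generator all_semigroups A) u l S Logic.I s
  = foldmul s (u S Logic.I s) l.
Proof. by elim: l u => //= a l IH u; rewrite IH. Qed.

Section Absorb.
Variables (H : finSemigroupType -> Prop) (A : finType) (a0 : A).
Hypothesis grpH : all_groups H.

(** The products of [e] with the prefixes of the word [enum A], preceded by
    [a0], are all R-equivalent to [e], hence in the maximal subgroup at [e].
    Two consecutive ones differ by a letter [a] on the right, so that their
    quotient in that group is [e * s a]. *)
Lemma letters_in_group (S : finSemigroupType) (s : A -> S) (e : S) :
  DRH H S -> e * e = e -> le_R e (e * foldmul s (s a0) (enum A)) ->
  exists (G : finSemigroupType) (HG : H G) (i : {multiplicative G -> S})
         (phi : A -> G),
    e = i (group_one grpH HG) /\ forall a, e * s a = i (phi a).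
Proof.
move=> DS ee; rewrite foldmul_mull => le_e.
have [|G [i [HG grpG inj_i range_i]]] := DS e; first by exists e; rewrite ee.
have inR y : le_R e y -> le_R y e -> exists g, y = i g.
  by move=> ? ?; have : range i y by [rewrite range_i]; move=> [g _ <-]; exists g.
have [one eE] : exists g, e = i g by apply: inR; left.
have neutral_one : neutral one.
  by apply: group_idem_neutral grpG _; apply: inj_i; rewrite gmulfM -eE.
have prefix l1 l2 : enum A = l1 ++ l2 -> exists g, foldmul s (e * s a0) l1 = i g.
  move=> EA; apply: inR; last exact: le_R_trans (foldmul_le _ _ _) (le_R_mul _ _).
  apply: le_R_trans le_e _; rewrite EA /foldmul foldl_cat; exact: foldmul_le.
have letter a : exists g, e * s a = i g.
  have [l1 [l2 EA]] : exists l1 l2, enum A = l1 ++ a :: l2.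
    exists (take (index a (enum A)) (enum A)).
    exists (drop (index a (enum A)).+1 (enum A)).
    by rewrite -drop_index ?mem_enum ?cat_take_drop.
  have [g gE] := prefix l1 (a :: l2) EA.
  have [h hE] := prefix (rcons l1 a) l2 (etrans EA (esym (cat_rcons _ _ _))).
  have [b [neutral_b inv]] := grpG; have [g' [_ g'g]] := inv g.
  exists (g' * h); rewrite gmulfM -hE /foldmul foldl_rcons -/(foldmul _ _ _) gE.
  by rewrite mulgA -gmulfM g'g -(neutral_unique neutral_one neutral_b) -eE.
have /choice [phi phiE] := letter.
exists G, HG, i, phi; split=> //.
by rewrite -(neutral_unique neutral_one (group_oneP grpH HG)).
Qed.

(** The letter [a0] is a starting point for the product, as there is no
    empty product. *)
Definition full_idem : pseudoword A :=
  omega_word (foldmul (@generator all_semigroups A) (generator _ a0) (enum A)).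

(** The pairs [p] of [S * G] with [e * p.1 = i p.2] form a subsemigroup: as [e]
    is the identity of the group, [e * x * y = (e * x) * (e * y)] as soon as
    [e * x] belongs to it.  It contains the pairs of values of the letters,
    hence the pair of values of every pseudoword. *)
Lemma eval_full_idem (S : finSemigroupType) (s : A -> S) :
  DRH H S ->
  exists (G : finSemigroupType) (HG : H G) (i : {multiplicative G -> S})
         (phi : A -> G),
    forall u : adjI (pseudoword A),
      evalI (Some full_idem * u) s = Some (i (group_eval grpH u HG phi)).
Proof.
move=> DS; pose e := full_idem S Logic.I s.
have ee : e * e = e by exact: omega_idem.
have [|G [HG [i [phi [eE letterE]]]]] := letters_in_group (s := s) DS ee.
  have [n en] := omega_pow (foldmul s (s a0) (enum A)).
  have eE : e = pow (foldmul s (s a0) (enum A)) n by rewrite -en /e /= eval_foldmul.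
  rewrite -{1}ee {2}eE; case: n {en eE} => [|n]; first by left.
  by rewrite powS mulgA; apply: le_R_mul.
exists G, HG, i, phi => -[u|] /=; congr Some; last by rewrite -eE.
rewrite -/e.
pose P := [pred p : prod_sg S G | e * p.1 == i p.2].
pose t a : (prod_sg S G : finSemigroupType) := (s a, phi a).
have PM x y : x \in P -> y \in P -> x * y \in P.
  rewrite !inE => /eqP ex /eqP ey; apply/eqP.
  have -> : (x * y).1 = x.1 * y.1 by [].
  have -> : (x * y).2 = x.2 * y.2 by [].
  rewrite gmulfM -ey !mulgA; congr (_ * _).
  rewrite ex eE -gmulfM; congr (i _).
  by rewrite (group_oneP grpH HG _).2.
have /eqP : u _ Logic.I t \in P.
  apply: eval_closed PM _ _; first by exists.
  by move=> a; rewrite inE /= letterE.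
have fstM : {morph (fst : prod_sg S G -> S) : x y / x * y} by [].
have sndM : {morph (snd : prod_sg S G -> G) : x y / x * y} by [].
have := eval_natural u Logic.I Logic.I (multiplicative_of fstM) t.
have := eval_natural u Logic.I Logic.I (multiplicative_of sndM) t.
by move=> /= -> ->.
Qed.

Lemma absorb (u v : adjI (pseudoword A)) :
  eq_mod H u v -> eq_mod (DRH H) (Some full_idem * u) (Some full_idem * v).
Proof.
move=> /(eq_mod_group grpH) uv.
have SomeM w : exists x, Some full_idem * w = Some x :> adjI (pseudoword A).
  by case: w => [w|]; [exists (full_idem * w)|exists full_idem].
have [x xE] := SomeM u; have [y yE] := SomeM v.
rewrite xE yE /eq_mod /=; congr Some; apply: free_pro_ext => S DS s /=.
have [G [HG [i [phi ev]]]] := eval_full_idem s DS.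
have := ev v; have := ev u; rewrite uv xE yE /= => <- E.
by case: E.
Qed.

End Absorb.

(** * Reducibility *)

(** A nullary implicit operation would pick, in each finite semigroup, an
    element equal to all its idempotents, as an idempotent is the image of a
    morphism from the trivial semigroup; but [adjI unit] has two idempotents. *)
Lemma pseudoword_empty (A : Type) : (A -> False) -> pseudoword A -> False.
Proof.
move=> A0 u.
have constM (c : adjI unit) :
    {morph ((fun=> c) : unit -> adjI unit) : x y / x * y}.
  by case: c => [[]|].
pose f c := multiplicative_of (constM c).
pose s a : unit := match A0 a with end.
have := eval_natural u Logic.I Logic.I (f None) s.
have := eval_natural u Logic.I Logic.I (f (Some tt)) s.
suff -> : f (Some tt) \o s = f None \o s by move=> <-.
by apply/funext => a; case: (A0 a).
Qed.

(** The root is [None], and the edge [inr v] goes from the root to [v]. *)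
Definition rooted (G : digraph) : digraph :=
  @Digraph (option (vertex G)) (edge G + vertex G)%type
    (fun e => match e with inl e => Some (source e) | inr _ => None end)
    (fun e => match e with inl e => Some (target e) | inr v => Some v end).

Theorem proposition4p10 (sigma : operation_set)
    (H : finSemigroupType -> Prop) :
  implicit_signature sigma ->
  highly_computable sigma ->
  group_pseudovariety H ->
  re_pseudovariety H ->
  reducible sigma (DRH H) ->
  reducible sigma H.
Proof.
move=> _ _ [_ grpH] _ redDRH G A K clopK [d [cont_d eq_d K_d]].
have [[a0]|A0] := pselect (inhabited A); last first.
  exists d; split=> // x; case: (d _) => // u.
  by case: (pseudoword_empty (fun a => A0 (inhabits a)) u).
pose f : adjI (pseudoword A) := Some (full_idem a0).
pose K' (x : graph_var (rooted G)) : set (adjI (pseudoword A)) :=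
  match x with
  | inl _ => setT
  | inr (inl e) => K (inr e)
  | inr (inr v) => K (inl v)
  end.
have clopK' x : clopen (K' x).
  by case: x => [x|[e|v]] //=; apply: clopenT.
pose w (x : graph_var (rooted G)) : adjI (pseudoword A) :=
  match x with
  | inl None => f
  | inl (Some v) => f * d (vertex_word v)
  | inr (inl e) => d (edge_word e)
  | inr (inr v) => d (vertex_word v)
  end.
have [d' [cont_d' d'E]] := extension w.
have [|d1 [[_ eq_d1 K_d1] sigma_d1]] := redDRH (rooted G) A K' clopK'.
  exists d'; split=> //; last by case=> [x|[e|v]]; rewrite d'E //=; apply: K_d.
  case=> [e|v]; rewrite /graph_lhs /graph_rhs /vertex_word /edge_word gmulfM !d'E //=.
  (* The edges [inr v] hold as identities; those of [G] hold by absorption. *)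
  rewrite -mulgA; apply: (absorb a0 grpH).
  by have := eq_d e; rewrite gmulfM.
pose w1 (x : graph_var G) : adjI (pseudoword A) :=
  match x with
  | inl v => d1 (generator _ (inr (inr v)))
  | inr e => d1 (generator _ (inr (inl e)))
  end.
have [d2 [cont_d2 d2E]] := extension w1.
exists d2; split; last by case=> [v|e]; rewrite d2E; apply: sigma_d1.
split=> //.
  move=> e; apply/(eq_mod_group grpH) => S HS s.
  have eq1 x : group_eval grpH (d1 (graph_lhs x)) HS s
               = group_eval grpH (d1 (graph_rhs x)) HS s.
    apply: (eq_mod_group grpH _ _).1.
    exact: eq_mod_sub (fun S => group_sub_DRH grpH) grpH (eq_d1 x).
  have := eq1 (inl e); have := eq1 (inr (source e)); have := eq1 (inr (target e)).
  rewrite /graph_lhs /graph_rhs !gmulfM !group_evalM !d2E /= => <- <-.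
  rewrite -mulgA; exact: group_cancel (grpH S HS).
by case=> [v|e]; rewrite d2E; [exact: (K_d1 (inr (inr v)))|exact: (K_d1 (inr (inl e)))].
Qed.
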